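(* Let $r\ge 7$ be an integer. Then there is a constant $c_r>0$ such that for every positive integer $n$, every integer in the interval $\left[\frac{n^2}{2r}+c_rn,\ \frac{n^2-n}{2}-c_rn^{3/2}\right]$ belongs to $C(n,r)$.
   Context: For positive integers $n,r$, let $C(n,r)=\left\{\sum_{i=1}^{r}\binom{n_i}{2}:\ n_1,\dots,n_r \text{ non-negative integers with } \sum_{i=1}^{r}n_i=n\right\}$. *)

(* Defs.v *)
From HB Require Import structures.
From mathcomp Require Import all_boot all_order all_algebra.
From mathcomp Require Import classical_sets reals exp.

Set Implicit Arguments.
Unset Strict Implicit.
Unset Printing Implicit Defensive.

Import Order.TTheory GRing.Theory Num.Theory.

Local Open Scope classical_set_scope.
Local Open Scope ring_scope.

(* C(n, r) lives in int, not nat, so that membership can be asked of an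
   arbitrary integer. *)
Definition Cset (n r : nat) : set int :=
  [set m | exists2 f : 'I_r -> nat, (\sum_(i < r) f i)%N = n
           & m = (\sum_(i < r) 'C(f i, 2))%N%:Z].

(* Main.v *)
(** In terms of N = 2 m + n, the problem is to find r parts with sum n and sum
    of squares N.  The form x^2 + xy + y^2 + z^2 + zw + w^2 is the reduced norm
    of a quaternion order, and descent on multiples of a prime, as in Lagrange's
    four square theorem, shows that it represents every natural number.
    Perturbing six equal parts a by two triples of sum zero thus reaches every
    even number slightly above 6 a^2.  For r = 7 the last part is n - 6 a: going
    from a to a + 1 moves (n - 6 a)^2 + 6 a^2 by O(n), which is less than the
    length O(a^2) of the range available to the six parts as soon as a exceeds
    a multiple of sqrt n.  Larger r follow by induction. *)

Require Import Defs.
From HB Require Import structures.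
From mathcomp Require Import all_boot all_order all_algebra.
From mathcomp Require Import classical_sets reals exp.
From mathcomp Require Import zify ring lra.

Set Implicit Arguments.
Unset Strict Implicit.
Unset Printing Implicit Defensive.

Import Order.TTheory GRing.Theory Num.Theory.

Local Open Scope classical_set_scope.
Local Open Scope ring_scope.

(** * Universality of the sum of two Eisenstein norms *)

Definition eisnorm (x y : int) : int := x ^+ 2 + x * y + y ^+ 2.

Definition eisnorm2_value (m : int) : Prop :=
  exists x y z w : int, m = eisnorm x y + eisnorm z w.

(** Completing the square. This bound later keeps the six perturbed parts nonnegative. *)
Lemma eisnorm_ge_sqr x y : 3 * x ^+ 2 <= 4 * eisnorm x y.
Proof.
have -> : 4 * eisnorm x y = 3 * x ^+ 2 + (x + 2 * y) ^+ 2.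
  by rewrite /eisnorm; ring.
by rewrite lerDl sqr_ge0.
Qed.

Lemma eisnorm_ge0 x y : 0 <= eisnorm x y.
Proof. by have := eisnorm_ge_sqr x y; have := sqr_ge0 x; lia. Qed.

Lemma eisnormC x y : eisnorm x y = eisnorm y x.
Proof. by rewrite /eisnorm; ring. Qed.

Lemma eisnorm_eq0 x y : eisnorm x y = 0 -> x = 0 /\ y = 0.
Proof.
move=> h; have := eisnorm_ge_sqr x y; have := eisnorm_ge_sqr y x.
rewrite (eisnormC y x) h; split; nia.
Qed.

(* The reduced norm of the quaternions [alpha + beta j], with [alpha], [beta]
   Eisenstein integers, [j^2 = -1] and [j alpha = conj(alpha) j], is
   multiplicative. *)
Lemma eisnorm2_valueM m n :
  eisnorm2_value m -> eisnorm2_value n -> eisnorm2_value (m * n).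
Proof.
move=> [x [y [z [w ->]]]] [a [b [c [d ->]]]].
exists (x * a - y * b - (z * (c + d) + w * d)),
  (x * b + y * a + y * b - (w * (c + d) - z * d - w * d)),
  (x * c - y * d + (z * (a + b) + w * b)),
  (x * d + y * c + y * d + (w * (a + b) - z * b - w * b)).
by rewrite /eisnorm; ring.
Qed.

Lemma centered_residue (e m : int) : 0 < m ->
  exists q : int, - m <= e - 2 * m * q <= m.
Proof.
move=> m0; exists ((e + m) %/ (2 * m))%Z.
have h2 : 0 < 2 * m by lia.
have h1 := divz_eq (e + m) (2 * m).
have h3 := modz_ge0 (e + m) (lt0r_neq0 h2).
have h4 := ltz_pmod (e + m) h2.
nia.
Qed.

(** For the reduced coordinates, [4 * eisnorm X Y = 3 X^2 + (2 Y + X)^2], and rounding makes [2 X]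
    and [2 Y + X] at most [m] in absolute value. Since 7/16 + 7/16 < 1, two such norms add up to
    less than [m^2]. *)
Lemma eisnorm_residue (x y m : int) : 0 < m ->
  exists x' y' : int, 16 * eisnorm (x - m * x') (y - m * y') <= 7 * m ^+ 2.
Proof.
move=> m0; have [q hq] := centered_residue (2 * x) m0.
have [t ht] := centered_residue (2 * y + (x - m * q)) m0.
exists q, t; rewrite /eisnorm.
move: hq ht; set X := x - m * q; set Y := y - m * t => hq ht.
have {}hq : - m <= 2 * X <= m by rewrite /X; lia.
have {}ht : - m <= 2 * Y + X <= m by rewrite /X /Y; lia.
have h1 : (2 * X) ^+ 2 <= m ^+ 2 by nia.
have h2 : (2 * Y + X) ^+ 2 <= m ^+ 2 by nia.
nia.
Qed.

Lemma eisnorm2_descent (p m : nat) : prime p -> (0 < m < p)%N ->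
  eisnorm2_value (m%:Z * p%:Z) -> eisnorm2_value p%:Z.
Proof.
move=> pp; elim/ltn_ind: m => m IH /andP [m0 mp] [x [y [z [w E]]]].
have [m1|m1] := eqVneq m 1%N.
  by exists x, y, z, w; rewrite -E m1; ring.
have mZ : 0 < m%:Z by lia.
have [x' [y' hxy]] := eisnorm_residue x y mZ.
have [z' [w' hzw]] := eisnorm_residue z w mZ.
(* Let [xi], [xi'] be the quaternions with coordinates [x, y, z, w] and [x', y', z', w']. Then [S]
   is the norm of [xi'] and [T] the polar form at [xi], [xi'], so [xi - m xi'] has norm
   [m p - m T + m^2 S = m m']. *)
pose S := eisnorm x' y' + eisnorm z' w'.
pose T := 2 * x * x' + x * y' + y * x' + 2 * y * y'
  + (2 * z * z' + z * w' + w * z' + 2 * w * w').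
pose m' := p%:Z - T + m%:Z * S.
have red : m%:Z * m' =
    eisnorm (x - m%:Z * x') (y - m%:Z * y') + eisnorm (z - m%:Z * z') (w - m%:Z * w').
  rewrite /m' mulrDr mulrBr E /T /S /eisnorm; ring.
have m'0 : 0 <= m'.
  have := eisnorm_ge0 (x - m%:Z * x') (y - m%:Z * y').
  have := eisnorm_ge0 (z - m%:Z * z') (w - m%:Z * w').
  nia.
have m'm : m' < m%:Z by nia.
(* If [m' = 0], then [xi = m xi'], so [m] divides [p] although [1 < m < p]. *)
have [m'z|m'nz] := eqVneq m' 0.
  exfalso.
  have h1 := eisnorm_ge0 (x - m%:Z * x') (y - m%:Z * y').
  have h2 := eisnorm_ge0 (z - m%:Z * z') (w - m%:Z * w').
  rewrite m'z mulr0 in red.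
  have /eisnorm_eq0 [e1 e2] : eisnorm (x - m%:Z * x') (y - m%:Z * y') = 0 by lia.
  have /eisnorm_eq0 [e3 e4] : eisnorm (z - m%:Z * z') (w - m%:Z * w') = 0 by lia.
  have pS : p%:Z = m%:Z * S.
    apply: (mulfI (lt0r_neq0 mZ)); rewrite E.
    move/subr0_eq: e1 => ->; move/subr0_eq: e2 => ->.
    move/subr0_eq: e3 => ->; move/subr0_eq: e4 => ->.
    by rewrite /S /eisnorm; ring.
  have /(prime_nt_dvdP pp m1) : (m %| p)%N.
    by rewrite -[(m %| p)%N]/(m%:Z %| p%:Z)%Z pS dvdz_mulr.
  lia.
apply: (IH `|m'|%N); [lia|lia|].
rewrite gez0_abs //.
(* These are the coordinates of [p - xi conj(xi')], which is [xi conj(xi - m xi') / m], in the basis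
   1, [w] of the Eisenstein integers with [w^2 = w - 1]. *)
exists (p%:Z - (x * (x' + y') + y * y') - (z * (z' + w') + w * w')),
  (- (y * x' - x * y') - (w * z' - z * w')),
  (x * z' - y * w' - (z * x' - w * y')),
  (x * w' + y * z' + y * w' - (z * y' + w * x' + w * y')).
transitivity (p%:Z ^+ 2 - p%:Z * T + m%:Z * p%:Z * S).
  by rewrite /m'; ring.
by rewrite E /T /S /eisnorm; ring.
Qed.

(** Pigeonhole: the squares [a^2] and the values [-(b^2 + b + 1)], for [a, b <= (p - 1) / 2], are
    [p + 1] residues modulo [p], without repetition inside either family. *)
Lemma prime_dvd_eisnorm2 (p : nat) : prime p -> odd p ->
  exists a b : nat, [/\ (2 * a < p)%N, (2 * b < p)%N
    & (p %| a ^ 2 + (b ^ 2 + b + 1))%N].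
Proof.
move=> pp po; pose h := p./2.+1.
have hp : (2 * h = p.+1)%N by rewrite /h; lia.
have p0 := prime_gt0 pp.
pose F (u : 'I_h + 'I_h) : 'I_p := match u with
  | inl a => Ordinal (ltn_pmod (a ^ 2) p0)
  | inr b => Ordinal (ltn_pmod (p ^ 2 - (b ^ 2 + b + 1)) p0)
  end.
(* Hence the subtraction from [p ^ 2] in [F] is not truncated and gives the opposite residue. *)
have hb (b : 'I_h) : (b ^ 2 + b + 1 <= p ^ 2)%N by have := ltn_ord b; nia.
have sq_inj (a a' : 'I_h) : (a' <= a)%N -> a ^ 2 = a' ^ 2 %[mod p] -> a = a'.
  move=> le_a' /eqP; rewrite eqn_mod_dvd ?leq_sqr // subn_sqr Euclid_dvdM //.
  have ha := ltn_ord a; case/orP => /dvdn_leq le; apply: val_inj => /=.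
    by have [|/le] := posnP (a - a'); lia.
  by have [|/le] := posnP (a + a'); lia.
have tri_inj (b b' : 'I_h) : (b' <= b)%N ->
    p ^ 2 - (b ^ 2 + b + 1) = p ^ 2 - (b' ^ 2 + b' + 1) %[mod p] -> b = b'.
  have h1 := hb b; have h2 := hb b'.
  move=> le_b' /eqP; rewrite eq_sym eqn_mod_dvd; last by nia.
  have -> : (p ^ 2 - (b' ^ 2 + b' + 1) - (p ^ 2 - (b ^ 2 + b + 1)) =
             (b - b') * (b + b' + 1))%N by nia.
  rewrite Euclid_dvdM //.
  have ha := ltn_ord b; have ha' := ltn_ord b'.
  case/orP => /dvdn_leq le; apply: val_inj => /=.
    by have [|/le] := posnP (b - b'); lia.
  (* Here [p <= b + b' + 1] can occur, but only with [b = b' = (p - 1) / 2]. *)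
  by have := le ltac:(lia); lia.
have /injectivePn [u [v uv Fuv]] : ~~ injectiveb F.
  apply/negP => /injectiveP /leq_card; rewrite card_sum !card_ord; lia.
have cross (a b : 'I_h) : F (inl a) = F (inr b) ->
    exists a b : nat, [/\ (2 * a < p)%N, (2 * b < p)%N
      & (p %| a ^ 2 + (b ^ 2 + b + 1))%N].
  move=> /(congr1 val) /= eab; have := ltn_ord a; have := ltn_ord b.
  exists a, b; split; [lia|lia|].
  rewrite /dvdn -modnDml eab modnDml subnK //.
  by rewrite -[_ == _]/(p %| p ^ 2)%N dvdn_exp.
case: u v uv Fuv => [a|b] [a'|b'] uv Fuv; last 3 first.
- exact: cross Fuv.
- exact/cross/esym/Fuv.
- case/eqP: uv; congr inr; move/(congr1 val): Fuv => /= e.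
  by case/orP: (leq_total b' b) => le; [|symmetry]; apply: tri_inj.
case/eqP: uv; congr inl; move/(congr1 val): Fuv => /= e.
by case/orP: (leq_total a' a) => le; [|symmetry]; apply: sq_inj.
Qed.

Lemma eisnorm2_value_prime (p : nat) : prime p -> eisnorm2_value p%:Z.
Proof.
move=> pp; have [po|/prime_oddPn] := boolP (odd p); last first.
  by move=> /(_ pp) ->; exists 1, 0, 1, 0; rewrite /eisnorm; lia.
have [a [b [ha hb /dvdnP [m Em]]]] := prime_dvd_eisnorm2 pp po.
have p1 := prime_gt1 pp.
(* The bounds on [a] and [b] give [0 < a^2 + b^2 + b + 1 < p^2], hence [0 < m < p]. *)
apply: (@eisnorm2_descent p m pp); first by nia.
exists a%:Z, 0, b%:Z, 1; rewrite /eisnorm -PoszM -Em; lia.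
Qed.

Lemma eisnorm2_universal (m : nat) : eisnorm2_value m%:Z.
Proof.
elim/ltn_ind: m => m IH.
have [m2|m2] := ltnP m 2.
  by exists m%:Z, 0, 0, 0; rewrite /eisnorm; case: m m2 {IH} => [|[|]].
have pm := pdiv_prime m2.
rewrite -(divnK (pdiv_dvd m)) PoszM.
apply: eisnorm2_valueM (eisnorm2_value_prime pm).
by apply/IH/ltn_Pdiv; [exact: prime_gt1|lia].
Qed.

(** * Parts with prescribed sum and sum of squares *)

Local Open Scope nat_scope.

Definition square_rep (r n N : nat) : Prop :=
  exists s : seq nat, [/\ size s = r, \sum_(x <- s) x = n
    & \sum_(x <- s) x ^ 2 = N].

Lemma square_rep_cons r n N t :
  square_rep r n N -> square_rep r.+1 (t + n) (t ^ 2 + N).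
Proof.
by move=> [s [<- <- <-]]; exists (t :: s); rewrite !big_cons.
Qed.

(* The parts are [a + x, a + y, a - x - y, a + z, a + w, a - z - w]. *)
Lemma square_rep6 a M : 4 * M <= 3 * a ^ 2 ->
  square_rep 6 (6 * a) (6 * a ^ 2 + 2 * M).
Proof.
move=> hM; have [x [y [z [w E]]]] := eisnorm2_universal M.
have small (u v t : int) : (eisnorm u v + t = M%:Z -> 0 <= t ->
    - a%:Z <= u <= a%:Z)%R.
  move=> e t0; have h := eisnorm_ge_sqr u v; nia.
(* The norm is symmetric in [u], [v], [-(u + v)], so [small] also bounds the third deviation of each
   triple. *)
have eisN (u v : int) : eisnorm (- (u + v)) u = eisnorm u v.
  by rewrite /eisnorm; ring.
have nxy := eisnorm_ge0 x y; have nzw := eisnorm_ge0 z w.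
have hx := small x y (eisnorm z w) ltac:(lia) nzw.
have hy := small y x (eisnorm z w) ltac:(rewrite eisnormC; lia) nzw.
have hxy := small (- (x + y))%R x (eisnorm z w) ltac:(rewrite eisN; lia) nzw.
have hz := small z w (eisnorm x y) ltac:(lia) nxy.
have hw := small w z (eisnorm x y) ltac:(rewrite eisnormC; lia) nxy.
have hzw := small (- (z + w))%R z (eisnorm x y) ltac:(rewrite eisN; lia) nxy.
exists [:: `|(a%:Z + x)%R|; `|(a%:Z + y)%R|; `|(a%:Z - x - y)%R|;
  `|(a%:Z + z)%R|; `|(a%:Z + w)%R|; `|(a%:Z - z - w)%R|].
rewrite !big_cons !big_nil; split=> //; first by lia.
have sqrZ (v : int) : Posz (`|v| ^ 2) = (v ^+ 2)%R.
  by rewrite -abszX gez0_abs ?sqr_ge0.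
apply: (can_inj absz_nat).
(* Deviations [x, y, -(x + y)] have sum zero and sum of squares [2 * eisnorm x y]. *)
by rewrite -[a ^ 2]mulnn !PoszD !sqrZ !PoszM E /eisnorm; ring.
Qed.

(* With [s = ceil (sqrt n)], the hypothesis [N + c * n * s <= n ^ 2] is the
   upper bound [n^2 - O(n^(3/2))]; [N] is [2 m + n] in terms of the sum [m] of
   the binomial coefficients, whence the parity condition. *)
Definition square_rep_interval (r c : nat) : Prop :=
  forall n s N, n <= s ^ 2 -> odd N = odd n ->
    n ^ 2 + c * n <= r * N -> N + c * n * s <= n ^ 2 -> square_rep r n N.

(** For [n > 0], take the least [a] with [(n - 6 a)^2 + 6 a^2 <= N]. By minimality the excess [2 M]
    is at most [12 n], and the upper bound on [N] forces [a >= 3 s], so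
    [4 M <= 24 n <= 27 n <= 3 a^2]. *)
Lemma square_rep_interval7 : square_rep_interval 7 36.
Proof.
move=> n s N hs par lo hi.
have [n0|n0] := posnP n.
  have N0 : N = 0 by nia.
  by exists (nseq 7 0); rewrite n0 N0 /= !big_cons !big_nil.
pose P a := (6 * a <= n) && ((n - 6 * a) ^ 2 + 6 * a ^ 2 <= N).
have exP : exists a, P a.
  (* With [n = 7 q + u], [7 * ((q + u)^2 + 6 q^2) = n^2 + 6 u^2], and [6 u^2 <= 36 n]. *)
  exists (n %/ 7); rewrite /P.
  have := divn_eq n 7; have := ltn_pmod n (isT : 0 < 7).
  move: (n %/ 7) (n %% 7) => q u u7 En.
  apply/andP; split; first by lia.
  have -> : n - 6 * q = q + u by lia.
  have : u ^ 2 <= 6 * n by nia.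
  nia.
have [a /andP [a6 ga] amin] := ex_minnP exP.
have s0 : 0 < s by case: (posnP s) hs => // ->; lia.
have [b nE] : exists b, n = 6 * a + b by exists (n - 6 * a); lia.
have bE : n - 6 * a = b by lia.
rewrite bE in ga.
(* The constant 36 serves again: [36 n s <= n^2 - N <= n^2 - b^2 - 6 a^2 <= 12 a n]. *)
have as3 : 3 * s <= a.
  have : 36 * n * s <= 12 * a * n.
    have n2 : n ^ 2 = 36 * a ^ 2 + 12 * a * b + b ^ 2 by rewrite nE; ring.
    have an : 12 * a * n = 72 * a ^ 2 + 12 * a * b by rewrite nE; ring.
    lia.
  by rewrite (_ : 36 * n * s = 12 * n * (3 * s)) ?(mulnAC 12 a) ?leq_pmul2l //; lia.
have a0 : 0 < a by lia.
have gap : N < (b + 6) ^ 2 + 6 * (a - 1) ^ 2.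
  rewrite ltnNge; apply/negP => h; have := amin (a - 1).
  rewrite /P (_ : n - 6 * (a - 1) = b + 6) ?h; last by lia.
  by rewrite andbT => /(_ ltac:(lia)); lia.
have {}gap : N <= b ^ 2 + 6 * a ^ 2 + 12 * n.
  have [a' aE] : exists a', a = a'.+1 by exists a.-1; lia.
  move: gap; rewrite nE aE subn1 /=.
  have -> : (b + 6) ^ 2 + 6 * a' ^ 2 = b ^ 2 + 12 * b + 36 + 6 * a' ^ 2 by ring.
  have -> : 6 * a'.+1 ^ 2 = 6 * a' ^ 2 + 12 * a' + 6 by ring.
  lia.
have aa : 9 * n <= a ^ 2.
  have : (3 * s) ^ 2 <= a ^ 2 by rewrite leq_sqr.
  rewrite expnMn; lia.
have [M ME] : exists M, N = b ^ 2 + (6 * a ^ 2 + 2 * M).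
  exists (N - (b ^ 2 + 6 * a ^ 2))./2.
  suff : ~~ odd (N - (b ^ 2 + 6 * a ^ 2)) by lia.
  rewrite oddB // oddD oddM oddX par nE oddD oddM /=.
  by rewrite addbF addbb.
rewrite ME nE addnC; apply: square_rep_cons; apply: square_rep6.
lia.
Qed.

(* Near [n^2 / (r + 1)] the additional part is [n %/ (r + 1)]; above
   [n^2 / r + O(n)] it is [0]. *)
Lemma square_rep_intervalS r c : 7 <= r -> square_rep_interval r c ->
  square_rep_interval r.+1 (4 * c + 1).
Proof.
move=> r7 Q n s N hs par lo hi.
have [le|lt] := leqP (n ^ 2 + c * n) (r * N).
  rewrite -[n]add0n -[N]add0n -[X in X + N](exp0n (isT : 0 < 2)).
  by apply: square_rep_cons; apply: (Q n s) => //; nia.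
have := divn_eq n r.+1; have := ltn_pmod n (ltn0Sn r).
move: (n %/ r.+1) (n %% r.+1) => t u ur En.
pose k := r * t + u.
have nE : n = t + k by rewrite /k; nia.
(* In the constant [4 c + 1], the 1 pays for the rounding error [u^2 <= r n], and [4 c] for the
   linear term, as [r + 1 <= 4 r]. *)
have lo' : k ^ 2 + r * t ^ 2 + c * k <= r * N.
  have rn : u ^ 2 <= r * n.
    by rewrite -mulnn leq_mul //; lia.
  suff : r.+1 * (k ^ 2 + r * t ^ 2 + c * k) <= r.+1 * (r * N).
    by rewrite leq_pmul2l.
  apply: (@leq_trans (r * (n ^ 2 + (4 * c + 1) * n))); last first.
    by rewrite mulnCA leq_mul2l lo orbT.
  have kk : r.+1 * (k ^ 2 + r * t ^ 2) = r * n ^ 2 + u ^ 2.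
    by rewrite nE /k; ring.
  have ck : r.+1 * (c * k) <= r * (4 * c * n).
    rewrite (_ : r * (4 * c * n) = (4 * r) * (c * n)); last by ring.
    by apply: leq_mul; [lia | rewrite leq_mul2l nE leq_addl orbT].
  have rE : r * (n ^ 2 + (4 * c + 1) * n) = r * n ^ 2 + r * (4 * c * n) + r * n.
    by ring.
  by rewrite mulnDr kk rE; lia.
(* Here [N] is about [n^2 / 7] at most, or else small against the upper bound: [N7] plus five times
   [hi] gives [12 N + 19 c n s <= 6 n^2], while [n^2 <= 2 (t^2 + k^2)]. *)
have hi' : N + c * n * s <= t ^ 2 + k ^ 2.
  have tk : n ^ 2 <= 2 * (t ^ 2 + k ^ 2).
    by have := (nat_Cauchy t k).1; rewrite nE sqrnD; lia.
  have N7 : 7 * N <= n ^ 2 + c * n.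
    by apply: leq_trans (ltnW lt); rewrite leq_mul2r r7 orbT.
  have cs : c * n <= c * n * s.
    have [->|n0] := posnP n; first by rewrite muln0.
    by rewrite leq_pmulr //; case: (posnP s) hs => // ->; lia.
  have hiE : (4 * c + 1) * n * s = 4 * (c * n * s) + n * s by ring.
  lia.
have tN : t ^ 2 <= N.
  rewrite -(@leq_pmul2l r); last by lia.
  by apply: leq_trans lo'; rewrite -addnA addnCA leq_addr.
rewrite nE -(subnKC tN); apply: square_rep_cons; apply: (Q k s).
- by apply: leq_trans hs; rewrite nE leq_addl.
- by rewrite oddB // oddX par nE oddD /= addbAC addbb.
- by rewrite mulnBr; lia.
- have : c * k * s <= c * n * s.
    by rewrite leq_mul2r leq_mul2l nE leq_addl !orbT.
  lia.
Qed.

Lemma square_rep_interval_exists r : 7 <= r -> exists c, square_rep_interval r c.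
Proof.
elim: r => // r IH; rewrite leq_eqVlt => /predU1P [<-|r7].
  by exists 36; exact: square_rep_interval7.
by have [c /(square_rep_intervalS r7) Q] := IH r7; exists (4 * c + 1).
Qed.

(** * Return to binomial coefficients and real bounds *)

Lemma bin2_sqr x : 2 * 'C(x, 2) + x = x ^ 2.
Proof. by elim: x => // x IH; rewrite binS bin1; lia. Qed.

Lemma square_rep_Cset r n m : square_rep r n (2 * m + n) -> Cset n r m%:Z.
Proof.
move=> [s [<- sn sN]]; exists (fun i => nth 0 s i).
  by rewrite -sn (big_nth 0) big_mkord.
congr Posz; transitivity (\sum_(x <- s) 'C(x, 2)).
  suff : 2 * m + n = 2 * \sum_(x <- s) 'C(x, 2) + n by lia.
  rewrite -sN -[X in _ = _ + X]sn big_distrr -big_split /=.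
  by apply: eq_bigr => x _; rewrite bin2_sqr.
by rewrite (big_nth 0) big_mkord.
Qed.

(** For the least such [s], [s - 1 < sqrt n] and [1 <= sqrt n]; this converts the term [c n s] into
    [n^(3/2)]. *)
Lemma ceil_sqrt_exists (R : realType) n : 0 < n ->
  exists2 s, n <= s ^ 2 & (s%:R <= 2 * Num.sqrt (n%:R : R))%R.
Proof.
move=> n0; have exs : exists s, n <= s ^ 2 by exists n; nia.
have [s hs smin] := ex_minnP exs; exists s => //.
have s0 : 0 < s by case: (posnP s) hs => // ->; lia.
have lt_n : (s - 1) ^ 2 < n.
  by rewrite ltnNge; apply/negP => /smin; lia.
have sq1 : (1 <= Num.sqrt (n%:R : R))%R.
  by rewrite -[X in (X <= _)%R]sqrtr1 ler_sqrt ?ler0n // ler1n.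
have : ((s - 1)%:R <= Num.sqrt (n%:R : R))%R.
  rewrite -[X in (X <= _)%R]ger0_norm ?ler0n // -sqrtr_sqr ler_sqrt ?ler0n //.
  by rewrite -natrX ler_nat ltnW.
by rewrite natrB //; lra.
Qed.

Local Close Scope nat_scope.

Theorem theorem4p3 (R : realType) (r : nat) (hr : (7 <= r)%N) :
  exists2 c : R, 0 < c &
    forall n : nat, (0 < n)%N -> forall m : int,
      n%:R ^+ 2 / (2 * r%:R) + c * n%:R <= m%:~R ->
      m%:~R <= (n%:R ^+ 2 - n%:R) / 2 - c * n%:R `^ (3 / 2) ->
      Cset n r m.
Proof.
have [c Q] := square_rep_interval_exists hr.
(* The added 1 makes the constant positive. The factor 2 in [s <= 2 sqrt n] is matched by the
   doubling of [m] in [N = 2 m + n]. *)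
exists (c%:R + 1) => [|n n0 m lo hi]; first by rewrite ltr_wpDl ?ler0n.
have r0 : (0 : R) < r%:R by rewrite ltr0n; lia.
have nR : (0 : R) < n%:R by rewrite ltr0n.
have cR : (0 : R) <= c%:R by rewrite ler0n.
have m0 : 0 <= m.
  rewrite -(ler0z R); apply: le_trans lo; apply: addr_ge0.
    by rewrite divr_ge0 ?sqr_ge0 // mulr_ge0 // ltW.
  by rewrite mulr_ge0 ?ltW //; lra.
case: m m0 lo hi => // m _; rewrite -pmulrn => lo hi.
apply: square_rep_Cset.
have [s hs s_le] := ceil_sqrt_exists R n0.
apply: (Q n s) => //.
- by rewrite oddD oddM.
- rewrite -(ler_nat R) !(natrD, natrM, natrX).
  have {lo} : n%:R ^+ 2 + 2 * r%:R * ((c%:R + 1) * n%:R) <= 2 * r%:R * m%:R :> R.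
    have -> : n%:R ^+ 2 + 2 * r%:R * ((c%:R + 1) * n%:R) =
        2 * r%:R * (n%:R ^+ 2 / (2 * r%:R) + (c%:R + 1) * n%:R) :> R.
      by field; rewrite gt_eqF.
    by rewrite ler_pM2l // mulr_gt0.
  have r1 : 1 <= r%:R :> R by rewrite ler1n; lia.
  have cn : 0 <= c%:R * n%:R :> R by rewrite mulr_ge0 // ltW.
  nra.
- rewrite -(ler_nat R) !(natrD, natrM, natrX).
  have pw : n%:R `^ (3 / 2) = n%:R * Num.sqrt n%:R :> R.
    have -> : 3 / 2 = 1 + 2^-1 :> R by field.
    rewrite powRD; last by rewrite (gt_eqF nR) implybT.
    by rewrite powRr1 ?ler0n // powR12_sqrt ?ler0n.
  rewrite pw in hi.
  have cn : 0 <= c%:R * n%:R :> R by rewrite mulr_ge0 // ltW.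
  have := ler_wpM2l cn s_le.
  have : 0 <= n%:R * Num.sqrt n%:R :> R by rewrite mulr_ge0 ?sqrtr_ge0 ?ler0n.
  nra.
Qed.
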